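(* Let $\mathcal G=(M,w^-,w^+)$ be a conditioned weighted graph, with $M$ of order $N$, and let $\pi$ be the stationary measure on $\{1,\dots,N\}$ associated with the limit weighted measure of $\mathcal G$. Then, for every function $f:\{1,\dots,N\}\to\mathbb R$, the sequence of ergodic means $R_kf$, where $R_kf$ is considered as a random variable on the probability space $(G_k,\mu_k)$, converges in distribution as $k\to\infty$ toward the Dirac measure $\delta_{\gamma_f}$, where $$\gamma_f=\sum_{j=1}^N\pi(j)f(j).$$
   Context: A conditioned weighted graph is a triple $\mathcal G=(M,w^-,w^+)$ where $M$ is a non-negative real $N\times N$ matrix, $N>1$, and $w^-,w^+:\{1,\dots,N\}\to[0,\infty)$ (identified with a row vector and a column vector respectively), such that: (i) $M$ has a unique eigenvalue $\lambda$ of maximal modulus, and it is simple (then $\lambda$ is real and positive, and there exist non-negative left (row) and right (column) $\lambda$-eigenvectors $\ell$, $r$ with $\ell\cdot r=1$); (ii) $w^-\cdot r>0$ and $\ell\cdot w^+>0$. A path of length $k\geq0$ is a sequence $(x_0,\dots,x_k)$ of indices with $M_{x_i,x_{i+1}}>0$ for $0\leq i<k$; its weight is $w(x)=w^-(x_0)M_{x_0,x_1}\cdots M_{x_{k-1},x_k}w^+(x_k)$. $G_k$ is the set of paths of length $k$, and the weighted distribution $\mu_k$ on $G_k$ is $\mu_k(z)=w(z)/Z_k$, $Z_k=\sum_{z\in G_k}w(z)$, well defined ($Z_k>0$) for all $k$ large enough. As $k\to\infty$, the $\mu_k$ converge weakly (on the compact space of finite or infinite paths) to a probability measure on infinite paths,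 called the limit weighted measure, under which the successive vertices form a Markov chain with transition matrix $P_{i,j}=\lambda^{-1}M_{i,j}r(j)/r(i)$ on states with $r(i)\neq0$; the associated stationary measure is $\pi(i)=\ell(i)r(i)$, $1\leq i\leq N$. For $f:\{1,\dots,N\}\to\mathbb R$ and a path $z=(x_0,\dots,x_k)$, the ergodic mean is $R_kf(z)=\frac1{k+1}\sum_{i=0}^kf(x_i)$. *)

(* Defs.v *)
From HB Require Import structures.
From mathcomp Require Import all_boot all_order all_algebra.
From mathcomp Require Import complex.
From mathcomp Require Import all_classical all_reals all_analysis.

Set Implicit Arguments.
Unset Strict Implicit.
Unset Printing Implicit Defensive.

Import Order.TTheory GRing.Theory Num.Theory.
Import numFieldNormedType.Exports.

Local Open Scope classical_set_scope.
Local Open Scope ring_scope.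

Section Perron.
Variables (R : realType) (N : nat).
Implicit Types (M : 'M[R]_N) (lam : R[i]).

Definition complex_mx m n (A : 'M[R]_(m, n)) : 'M[R[i]]_(m, n) :=
  map_mx (real_complex R) A.

(* Simplicity is algebraic: lam is a simple root of the characteristic
   polynomial. *)
Definition simple_dominant_eigenvalue M lam : Prop :=
  [/\ eigenvalue (complex_mx M) lam,
      forall mu, eigenvalue (complex_mx M) mu -> mu != lam -> `|mu| < `|lam|
    & mup lam (char_poly (complex_mx M)) = 1%N].

(* Such a pair exists as soon as M >= 0 has a simple dominant eigenvalue
   (Perron-Frobenius), and is then unique up to (l, r) |-> (c^-1 l, c r) with
   c > 0. *)
Definition perron_pair M lam (l : 'rV[R]_N) (r : 'cV[R]_N) : Prop :=
  [/\ forall i, 0 <= l 0 i,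
      forall i, 0 <= r i 0,
      complex_mx l *m complex_mx M = lam *: complex_mx l,
      complex_mx M *m complex_mx r = lam *: complex_mx r
    & (l *m r) 0 0 = 1].

End Perron.

Record cond_weighted_graph (R : realType) (N : nat) := CondWeightedGraph {
  cwg_mx : 'M[R]_N;
  cwg_in : 'rV[R]_N;
  cwg_out : 'cV[R]_N;
  cwg_order : (1 < N)%N;
  cwg_mx_ge0 : forall i j, 0 <= cwg_mx i j;
  cwg_in_ge0 : forall i, 0 <= cwg_in 0 i;
  cwg_out_ge0 : forall i, 0 <= cwg_out i 0;
  cwg_dominant : exists lam, simple_dominant_eigenvalue cwg_mx lam;
  cwg_pos : forall lam l r, simple_dominant_eigenvalue cwg_mx lam ->
    perron_pair cwg_mx lam l r ->
    0 < (cwg_in *m r) 0 0 /\ 0 < (l *m cwg_out) 0 0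
}.

Section Paths.
Variables (R : realType) (N : nat) (G : cond_weighted_graph R N).
Local Notation M := (cwg_mx G).

(* The i-th step of z = (x_0, ..., x_k) goes from x_i to x_(i+1). *)
Definition step_src k (z : {ffun 'I_k.+1 -> 'I_N}) (i : 'I_k) : 'I_N :=
  z (widen_ord (leqnSn k) i).
Definition step_dst k (z : {ffun 'I_k.+1 -> 'I_N}) (i : 'I_k) : 'I_N :=
  z (lift ord0 i).

Definition is_path k (z : {ffun 'I_k.+1 -> 'I_N}) : bool :=
  [forall i : 'I_k, 0 < M (step_src z i) (step_dst z i)].

Definition cwg_path (k : nat) : finType :=
  {z : {ffun 'I_k.+1 -> 'I_N} | is_path z}.

Definition path_weight k (z : cwg_path k) : R :=
  cwg_in G 0 (val z ord0)
  * (\prod_(i < k) M (step_src (val z) i) (step_dst (val z) i))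
  * cwg_out G (val z ord_max) 0.

Definition partition_fun (k : nat) : R := \sum_(z : cwg_path k) path_weight z.

(* Identically 0 when partition_fun k = 0, which happens for finitely many k
   only. *)
Definition weighted_distribution k (z : cwg_path k) : R :=
  path_weight z / partition_fun k.

Lemma path_weight_ge0 k (z : cwg_path k) : 0 <= path_weight z.
Proof.
rewrite /path_weight !mulr_ge0 ?cwg_in_ge0 ?cwg_out_ge0//.
by apply: prodr_ge0 => i _; exact: cwg_mx_ge0.
Qed.

Lemma weighted_distribution_ge0 k (z : cwg_path k) :
  0 <= weighted_distribution z.
Proof.
rewrite divr_ge0 ?path_weight_ge0//.
by apply: sumr_ge0 => t _; exact: path_weight_ge0.
Qed.

Definition ergodic_mean (f : 'I_N -> R) k (z : cwg_path k) : R :=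
  k.+1%:R^-1 * \sum_(i < k.+1) f (val z i).

Definition stationary_measure (pi : 'I_N -> R) : Prop :=
  exists lam l r, [/\ simple_dominant_eigenvalue M lam, perron_pair M lam l r
    & forall i, pi i = l 0 i * r i 0].

End Paths.

Section FiniteLaw.
Local Open Scope ereal_scope.
Variables (R : realType) (T : finType) (mu : T -> {nonneg R}) (X : T -> R).

(* The image under X of the measure on T with point masses mu. *)
Definition finite_law (A : set R) : \bar R :=
  \sum_(t : T) (mu t)%:num%:E * \d_(X t) A.

Let finite_law0 : finite_law set0 = 0.
Proof. by rewrite /finite_law big1// => t _; rewrite measure0 mule0. Qed.

Let finite_law_ge0 A : 0 <= finite_law A.
Proof. by apply: sume_ge0 => t _; rewrite mule_ge0. Qed.

Let finite_law_sigma_additive : semi_sigma_additive finite_law.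
Proof.
move=> F mF tF mUF; rewrite /finite_law.
rewrite [X in X @ _ --> _](_ : _ = fun n => \sum_(t : T)
  \sum_(0 <= i < n) mscale (mu t) (\d_(X t)) (F i)); last first.
  by apply/funext => n; rewrite exchange_big.
apply: cvg_nnesum => t _.
  by apply: nearW => n; apply: sume_ge0.
exact: (@measure_semi_sigma_additive _ _ _ (mscale (mu t) (\d_(X t)))).
Qed.

HB.instance Definition _ := isMeasure.Build _ _ _ finite_law
  finite_law0 finite_law_ge0 finite_law_sigma_additive.

End FiniteLaw.

Definition ergodic_mean_law (R : realType) (N : nat)
    (G : cond_weighted_graph R N) (f : 'I_N -> R) (k : nat) :
    {measure set R -> \bar R} :=
  finite_law (fun z : cwg_path G k => NngNum (weighted_distribution_ge0 z))
             (@ergodic_mean R N G f k).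

Definition cvg_in_distribution (R : realType)
    (mu : nat -> {measure set R -> \bar R})
    (nu : {measure set R -> \bar R}) : Prop :=
  forall g : R -> R, continuous g -> (exists B, forall x, `|g x| <= B) ->
    (\int[mu k]_x (g x)%:E)%E @[k --> \oo] --> (\int[nu]_x (g x)%:E)%E.

(* Main.v *)
Require Import Defs.
From HB Require Import structures.
From mathcomp Require Import all_boot all_order all_algebra.
From mathcomp Require Import complex.
From mathcomp Require Import all_classical all_reals all_analysis.
From mathcomp Require Import measurable_realfun ring lra.

Set Implicit Arguments.
Unset Strict Implicit.
Unset Printing Implicit Defensive.

Import Order.TTheory GRing.Theory Num.Theory.
Import numFieldNormedType.Exports.

Local Open Scope classical_set_scope.
Local Open Scope ring_scope.

(** Let [h = f - gamma_f] and [A = M / lam].  By Chebyshev it is enough that the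
    second moment of [R_k h] under [mu_k] tends to 0, and in fact it is
    [O(1/k)].

    The spectral input is that [A ^+ k] converges geometrically fast to the
    rank one projector [P = r l] ([perron_powers]).  It needs no Jordan form.
    Deflate [M] to [B = M - lam *: r l]; the matrix determinant identity
    [deflated_char_poly] reads
    [char_poly B * char_poly (lam r l) = X^N * char_poly M], and comparing
    multiplicities at [lam] shows that every eigenvalue of [B] is smaller than
    [lam] in modulus.  By Cayley-Hamilton the powers of [B] are then killed by
    a product of first order difference operators, each with a ratio smaller
    than [lam], which forces geometric decay.

    For the second moment, weigh each path by [w^-] at its start times the
    entries of [A] along it, and let [m_p k] be the row vector whose [j]-th
    entry is the sum of [weight * S ^+ p] over the paths of length [k] ending at [j], where
    [S] is the sum of [h] along the path.  Appending a vertex gives linear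
    recursions for [m_p].  With [D] the diagonal matrix of [h],
    [m_1 k = \sum_(i <= k) w^- A^i D A^(k-i)].  Centering says [l D r = 0],
    that is [P D P = 0], so each term is
    [O(rho^i + rho^(k-i))] and [m_1] stays bounded; then [m_2 k] is a sum of
    [k+1] bounded terms, hence [O(k)] ([centered_second_moment_growth]).  The
    normalised partition function [w^- A^k w^+] tends to
    [(w^- r)(l w^+) > 0], so the second moment of [R_k h] is
    [O(k) / (k+1)^2] ([ergodic_mean_variance]).

    Convergence in law follows from the pointwise bound
    [|g x - g a| <= eps + c (x - a)^2], valid for bounded [g] continuous at
    [a] ([continuous_quadratic_bound]), by integrating it. *)

(** * The entrywise sum norm *)

Section EntrySumNorm.
Variable F : numDomainType.

(** Unlike the maximum norm, this one is submultiplicative for rectangular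
    matrices without a dimensional constant. *)
Definition mxl1 m n (A : 'M[F]_(m, n)) : F := \sum_i \sum_j `|A i j|.

Lemma mxl1_ge0 m n (A : 'M[F]_(m, n)) : 0 <= mxl1 A.
Proof. by apply: sumr_ge0 => i _; apply: sumr_ge0. Qed.

Lemma mxl1_0 m n : mxl1 (0 : 'M[F]_(m, n)) = 0.
Proof. by apply: big1 => i _; apply: big1 => j _; rewrite mxE normr0. Qed.

Lemma mxl1D m n (A B : 'M[F]_(m, n)) : mxl1 (A + B) <= mxl1 A + mxl1 B.
Proof.
rewrite /mxl1 -big_split; apply: ler_sum => i _.
by rewrite -big_split; apply: ler_sum => j _; rewrite mxE ler_normD.
Qed.

Lemma mxl1Z m n c (A : 'M[F]_(m, n)) : mxl1 (c *: A) = `|c| * mxl1 A.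
Proof.
rewrite /mxl1 mulr_sumr; apply: eq_bigr => i _; rewrite mulr_sumr.
by apply: eq_bigr => j _; rewrite mxE normrM.
Qed.

Lemma mxl1_sum m n I (s : seq I) (A : I -> 'M[F]_(m, n)) :
  mxl1 (\sum_(i <- s) A i) <= \sum_(i <- s) mxl1 (A i).
Proof.
elim/big_ind2: _ => [|B x C y hB hC|//]; first by rewrite mxl1_0.
exact: le_trans (mxl1D _ _) (lerD hB hC).
Qed.

Lemma mxl1_entry m n (A : 'M[F]_(m, n)) i j : `|A i j| <= mxl1 A.
Proof.
rewrite /mxl1 (bigD1 i)//= (bigD1 j)//= -addrA lerDl addr_ge0//.
  exact: sumr_ge0.
by apply: sumr_ge0 => k _; apply: sumr_ge0.
Qed.

Lemma mxl1M m n p (A : 'M[F]_(m, n)) (B : 'M[F]_(n, p)) :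
  mxl1 (A *m B) <= mxl1 A * mxl1 B.
Proof.
rewrite {1 2}/mxl1 mulr_suml; apply: ler_sum => i _.
apply: (@le_trans _ _ (\sum_j \sum_k `|A i k| * `|B k j|)).
  apply: ler_sum => j _; rewrite mxE.
  apply: le_trans (ler_norm_sum _ _ _) _.
  by apply: ler_sum => k _; rewrite normrM.
rewrite exchange_big mulr_suml /=; apply: ler_sum => k _.
rewrite -mulr_sumr ler_wpM2l// /mxl1 [leRHS](bigD1 k)//= lerDl.
by apply: sumr_ge0 => k' _; apply: sumr_ge0.
Qed.

End EntrySumNorm.

(** * Powers of a matrix with a simple dominant eigenvalue *)

Section SpectralBound.
Variable F : numClosedFieldType.

(** Any rate [q] above both [|mu|] and the rate of the forcing term works: at
    such a rate the forcing is absorbed by the gap [q - |mu|].  The case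
    [|mu| >= q0] is why the rate has to be enlarged, hence quantified
    existentially. *)
Lemma geometric_decay_first_order m n (lam mu : F) (a : nat -> 'M[F]_(m, n)) :
  `|mu| < lam ->
  (exists q K, [/\ 0 <= q, q < lam, 0 <= K &
     forall k, mxl1 (a k.+1 - mu *: a k) <= K * q ^+ k]) ->
  exists q K, [/\ 0 <= q, q < lam, 0 <= K &
     forall k, mxl1 (a k) <= K * q ^+ k].
Proof.
move=> mulam [q0 [K [q0_ge0 q0lam K0 hb]]].
have [q [q_ge0 qlam q0q muq]] : exists q, [/\ 0 <= q, q < lam, q0 <= q & `|mu| < q].
  have [muq|qmu] := real_ltP (normr_real mu) (ger0_real q0_ge0).
    by exists q0; split.
  have [muh hlam] := midf_lt mulam; exists ((`|mu| + lam) / 2); split=> //.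
  - exact: le_trans (ltW muh).
  - exact: le_trans qmu (ltW muh).
have d_gt0 : 0 < q - `|mu| by rewrite subr_gt0.
(* [K / (q - |mu|)] is the fixed point of [C |-> (|mu| C + K) / q]. *)
exists q, (mxl1 (a 0) + K / (q - `|mu|)).
have C0 : 0 <= K / (q - `|mu|) by rewrite divr_ge0// ltW.
split=> //; first by rewrite addr_ge0// mxl1_ge0.
elim=> [|k IH]; first by rewrite expr0 mulr1 lerDl.
have -> : a k.+1 = mu *: a k + (a k.+1 - mu *: a k) by rewrite addrC subrK.
apply: le_trans (mxl1D _ _) _; rewrite mxl1Z.
have hbk : mxl1 (a k.+1 - mu *: a k) <= K * q ^+ k.
  by apply: le_trans (hb k) _; rewrite ler_wpM2l// lerXn2r// nnegrE.
apply: le_trans (lerD (ler_wpM2l (normr_ge0 mu) IH) hbk) _.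
rewrite exprS [X in X + _]mulrA -mulrDl [leRHS]mulrA ler_wpM2r ?exprn_ge0//.
have -> : K = K / (q - `|mu|) * (q - `|mu|) by rewrite divfK// gt_eqF.
set C := K / _; rewrite -subr_ge0.
have -> : (mxl1 (a 0) + C * (q - `|mu|) / (q - `|mu|)) * q -
   (`|mu| * (mxl1 (a 0) + C * (q - `|mu|) / (q - `|mu|)) + C * (q - `|mu|)) =
   mxl1 (a 0) * (q - `|mu|) by rewrite mulfK ?gt_eqF//; ring.
by rewrite mulr_ge0 ?mxl1_ge0// ltW.
Qed.

(** Induction on the roots: if [C' = (B - z) C] then [B^k C'] is the first order
    difference [B^(k+1) C - z B^k C], and [C'] is annihilated by one factor
    less.  Allowing an arbitrary [C] is what makes the induction close. *)
Lemma geometric_decay_annihilated n m (lam : F) (B : 'M[F]_n.+1) (s : seq F)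
    (C : 'M[F]_(n.+1, m)) :
  0 < lam -> (forall z, z \in s -> `|z| < lam) ->
  horner_mx B (\prod_(z <- s) ('X - z%:P)) *m C = 0 ->
  exists q K, [/\ 0 <= q, q < lam, 0 <= K &
    forall k, mxl1 (B ^+ k *m C) <= K * q ^+ k].
Proof.
move=> lam0; elim: s C => [|z s IH] C hs.
  rewrite big_nil rmorph1 mul1mx => ->.
  by exists 0, 0; split=> // k; rewrite mulmx0 mxl1_0 mul0r.
rewrite big_cons mulrC rmorphM rmorphB /= horner_mx_X horner_mx_C -mulmxE.
rewrite -mulmxA => /IH[x xs|q [K [q0 qlam K0 hK]]].
  by apply: hs; rewrite in_cons xs orbT.
apply: (@geometric_decay_first_order _ _ _ z); first by rewrite hs// mem_head.
exists q, K; split=> // k; apply: le_trans (hK k).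
rewrite exprSr -mulmxE mulmxBl mulmxBr mulmxA mul_scalar_mx.
by rewrite -scalemxAr.
Qed.

(** Since [(M - P) P = 0] for [P = lam r l], expanding gives
    [(X - (M - P)) (X - P) = X (X - M)]; take determinants. *)
Lemma deflated_char_poly n (M : 'M[F]_n) (lam : F) (l : 'rV[F]_n)
    (r : 'cV[F]_n) :
  M *m r = lam *: r -> (l *m r) 0 0 = 1 ->
  char_poly (M - lam *: (r *m l)) * char_poly (lam *: (r *m l)) =
  'X^n * char_poly M.
Proof.
move=> Mr lr1.
have lr : l *m r = 1%:M by rewrite [LHS]mx11_scalar lr1.
set P := lam *: (r *m l); set B := M - P.
have BP : B *m P = 0.
  have MP : M *m P = lam *: P by rewrite /P -scalemxAr mulmxA Mr -scalemxAl.
  have PP : P *m P = lam *: P.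
    by rewrite {1}/P -scalemxAl /P -scalemxAr mulmxA -(mulmxA r) lr mulmx1.
  by rewrite /B mulmxBl MP PP subrr.
rewrite /char_poly -det_mulmx -detZ; congr (\det _).
rewrite /char_poly_mx mulmxBl !mulmxBr mul_scalar_mx mul_mx_scalar.
rewrite -map_mxM BP map_mx0 subr0.
rewrite mul_scalar_mx -!scalerBr -addrA -opprD -map_mxD.
by rewrite [P + B]addrC subrK.
Qed.

(** The deflated matrix [B] satisfies [B^k (1 - r l) = M^k - lam^k r l], so it is
    enough that its eigenvalues are all smaller than [lam].  Working with the
    algebraic multiplicity throughout avoids showing first that the eigenspace
    of [lam] is a line. *)
Lemma dominant_eigenvalue_powers n (M : 'M[F]_n.+1) (lam : F)
    (l : 'rV[F]_n.+1) (r : 'cV[F]_n.+1) :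
  0 < lam ->
  (forall mu, eigenvalue M mu -> mu != lam -> `|mu| < lam) ->
  mup lam (char_poly M) = 1%N ->
  l *m M = lam *: l -> M *m r = lam *: r -> (l *m r) 0 0 = 1 ->
  exists q K, [/\ 0 <= q, q < lam, 0 <= K &
    forall k, mxl1 (M ^+ k - lam ^+ k *: (r *m l)) <= K * q ^+ k].
Proof.
move=> lam0 dom mup1 lM Mr lr1.
have lr : l *m r = 1%:M by rewrite [LHS]mx11_scalar lr1.
have l0 : l != 0.
  by apply: contra_eqN lr1 => /eqP ->; rewrite mul0mx mxE eq_sym oner_eq0.
have := deflated_char_poly Mr lr1.
set P := r *m l; set B := M - _ => cpE.
have Bdom z : root (char_poly B) z -> `|z| < lam.
  move=> rz.
  have rBP : root (char_poly B * char_poly (lam *: P)) z by rewrite rootM rz.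
  have : root (char_poly (lam *: P)) lam.
    rewrite -eigenvalue_root_char; apply/eigenvalueP; exists l => //.
    by rewrite -scalemxAr mulmxA lr mul1mx.
  have nz (A : 'M[F]_n.+1) : char_poly A != 0 by rewrite monic_neq0// char_poly_monic.
  rewrite -dvdp_XsubCl XsubC_dvd ?nz// => mupP.
  have [zlam|zlam] := eqVneq z lam.
    (* The factor [lam r l] already uses up the simple root [lam]. *)
    have : (0 < mup lam (char_poly B))%N by rewrite -XsubC_dvd ?nz// dvdp_XsubCl -zlam.
    have := congr1 (mup lam) cpE.
    rewrite mupM ?nz// mupMr ?mup1; last first.
      by rewrite /root hornerXn expf_neq0// gt_eqF.
    by case: (mup _ _) => // a; case: (mup _ _) mupP => // b _; rewrite addnS.
  move: rBP; rewrite cpE rootM => /orP[|rM]; last first.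
    by apply: dom => //; rewrite eigenvalue_root_char.
  by rewrite /root hornerXn expf_eq0 /= => /eqP ->; rewrite normr0.
have [s sE] := closed_field_poly_normal (char_poly B).
rewrite (eqP (char_poly_monic B)) scale1r in sE.
have MP : M *m P = lam *: P by rewrite /P mulmxA Mr scalemxAl.
have PM : P *m M = lam *: P by rewrite /P -mulmxA lM scalemxAr.
have PP : P *m P = P by rewrite /P mulmxA -(mulmxA r) lr mulmx1.
have BP : B *m P = 0 by rewrite /B mulmxBl MP -scalemxAl PP subrr.
have [||q [K [q0 qlam K0 hK]]] :=
    @geometric_decay_annihilated _ _ lam B s (1%:M - P) lam0.
  by move=> z zs; apply: Bdom; rewrite sE root_prod_XsubC.
  by rewrite -sE Cayley_Hamilton mul0mx.
exists q, K; split=> // k; apply: le_trans (hK k).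
suff -> : B ^+ k *m (1%:M - P) = M ^+ k - lam ^+ k *: P by [].
elim: k => [|k IH]; first by rewrite !expr0 mul1mx scale1r.
rewrite exprS -mulmxE -mulmxA IH mulmxBr -scalemxAr BP scaler0 subr0.
rewrite /B mulmxBl -scalemxAl.
have PMk : P *m M ^+ k = lam ^+ k *: P.
  elim: k {IH} => [|k IHk]; first by rewrite mulmx1 scale1r.
  by rewrite exprS -mulmxE mulmxA PM -scalemxAl IHk scalerA -exprS.
by rewrite PMk !exprS -mulmxE scalerA.
Qed.

End SpectralBound.

(** * Perron data of a real nonnegative matrix *)

Section RealPerron.
Variable R : realType.

Lemma mxl1_complex m n (A : 'M[R]_(m, n)) :
  mxl1 (complex_mx A) = (mxl1 A)%:C%C.
Proof.
rewrite /mxl1 rmorph_sum; apply: eq_bigr => i _ /=; rewrite rmorph_sum.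
apply: eq_bigr => j _ /=; rewrite mxE normc_def /=.
by rewrite expr0n addr0 sqrtr_sqr.
Qed.

(** This is where [N > 1] matters: a simple eigenvalue leaves room for another
    one, whose modulus is strictly smaller. *)
Lemma dominant_eigenvalue_neq0 N (M : 'M[R]_N) lam :
  (1 < N)%N -> simple_dominant_eigenvalue M lam -> lam != 0.
Proof.
move=> N1 [_ dom mup1].
have [s sE] := closed_field_poly_normal (char_poly (complex_mx M)).
rewrite (eqP (char_poly_monic _)) scale1r in sE.
have sN : size s = N.
  by apply: succn_inj; rewrite -(size_char_poly (complex_mx M)) sE size_prod_XsubC.
have [/hasP[z zs zlam]|/hasPn all_lam] := boolP (has (predC1 lam) s).
  have := dom z; rewrite eigenvalue_root_char sE root_prod_XsubC => /(_ zs zlam).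
  by apply: contraTneq => ->; rewrite normr0 normr_lt0.
move: mup1; rewrite sE mu_prod_XsubC => count1.
have : count_mem lam s = size s.
  by apply/eqP; rewrite -all_count; apply/allP => z /all_lam /negPn.
by rewrite count1 sN => N1'; move: N1; rewrite -N1'.
Qed.

(** [l M r] is real and nonnegative, and equals [lam] because [l r = 1]. *)
Lemma perron_pair_real N (M : 'M[R]_N) lam l r :
  (forall i j, 0 <= M i j) -> perron_pair M lam l r ->
  exists2 L : R, 0 <= L & lam = L%:C%C.
Proof.
move=> M0 [l0 r0 _ Mr lr1].
have Mr0 i : 0 <= (M *m r) i 0 by rewrite mxE sumr_ge0// => j _; rewrite mulr_ge0.
exists ((l *m (M *m r)) 0 0).
  by rewrite mxE sumr_ge0// => j _; rewrite mulr_ge0.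
have : complex_mx l *m (complex_mx M *m complex_mx r) = lam%:M.
  rewrite Mr -scalemxAr -map_mxM [l *m r]mx11_scalar lr1.
  by rewrite map_scalar_mx rmorph1 scalemx1.
by rewrite -!map_mxM => /matrixP/(_ 0 0); rewrite !mxE mulr1n.
Qed.

(** The matrix is divided by its dominant eigenvalue so that its powers
    converge. *)
Lemma perron_powers N (M : 'M[R]_N) lam l r :
  (1 < N)%N -> (forall i j, 0 <= M i j) ->
  simple_dominant_eigenvalue M lam -> perron_pair M lam l r ->
  exists L rho K : R, [/\ 0 < L, 0 <= rho, rho < 1, 0 <= K &
    forall k, mxl1 ((L^-1 *: M) ^+ k - r *m l) <= K * rho ^+ k].
Proof.
case: N M l r => [//|N] M l r N1 M0 dom pp.
have lam0 := dominant_eigenvalue_neq0 N1 dom.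
have [L L0 lamE] := perron_pair_real M0 pp.
have L_gt0 : 0 < L.
  by rewrite lt_neqAle L0 andbT eq_sym; apply: contraNneq lam0 => L00; rewrite lamE L00.
case: dom pp => _ dom mup1 [_ _ lM Mr lr1].
have clr1 : (complex_mx l *m complex_mx r) 0 0 = 1.
  by rewrite -map_mxM mxE lr1.
have lam_gt0 : 0 < lam by rewrite lamE ltcR.
have [|q [K [q0 qlam K0 hK]]] :=
    @dominant_eigenvalue_powers _ _ _ lam _ _ lam_gt0 _ mup1 lM Mr clr1.
  by move=> mu emu mulam; rewrite -[ltRHS](gtr0_norm lam_gt0); exact: dom.
have qE : q = (complex.Re q)%:C%C by rewrite RRe_real// ger0_real.
have KE : K = (complex.Re K)%:C%C by rewrite RRe_real// ger0_real.
exists L, (complex.Re q / L), (complex.Re K); split=> //.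
- by rewrite divr_ge0//; move: q0; rewrite {1}qE ler0c.
- by rewrite ltr_pdivrMr// mul1r -ltcR -qE -lamE.
- by rewrite -ler0c -KE.
move=> k.
have -> : (L^-1 *: M) ^+ k - r *m l = L ^- k *: (M ^+ k - L ^+ k *: (r *m l)).
  rewrite exprZn scalerBr scalerA exprVn mulVf ?scale1r// expf_neq0// gt_eqF//.
rewrite mxl1Z expr_div_n mulrA mulrC ger0_norm; last by rewrite invr_ge0 exprn_ge0.
rewrite ler_wpM2r// ?invr_ge0 ?exprn_ge0//.
rewrite -lecR -mxl1_complex rmorphM rmorphXn /= -qE -KE.
apply: le_trans (hK k); rewrite le_eqVlt; apply/orP; left; apply/eqP; congr mxl1.
have powC : complex_mx (M ^+ k) = complex_mx M ^+ k.
  elim: k => [|k IH]; first by rewrite !expr0 /complex_mx map_scalar_mx rmorph1.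
  by rewrite !exprS -!mulmxE -IH /complex_mx map_mxM.
rewrite -powC lamE /complex_mx map_mxB map_mxZ map_mxM; congr (_ - _ *: _).
by rewrite rmorphXn.
Qed.

End RealPerron.

(** * Growth of the centered second moment *)

Section MomentGrowth.
Variable R : realType.

Lemma affine_recurrence N (A : 'M[R]_N) (b x : nat -> 'rV[R]_N) :
  x 0 = b 0 -> (forall k, x k.+1 = x k *m A + b k.+1) ->
  forall k, x k = \sum_(i < k.+1) b i *m A ^+ (k - i).
Proof.
move=> x0 xS; elim=> [|k IH]; first by rewrite big_ord1 x0 mulmx1.
rewrite big_ord_recr /= subnn mulmx1 xS IH mulmx_suml; congr (_ + _).
by apply: eq_bigr => i _; rewrite -mulmxA mulmxE -exprSr subSn// -ltnS.
Qed.

Lemma geometric_sum_le (rho : R) k : 0 <= rho -> rho < 1 ->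
  \sum_(i < k) rho ^+ i <= (1 - rho)^-1.
Proof.
move=> rho0 rho1; have d0 : 0 < 1 - rho by rewrite subr_gt0.
rewrite -div1r ler_pdivlMr// mulrC -[1 - rho]opprB mulNr -subrX1 opprB.
by rewrite gerBl exprn_ge0.
Qed.

(** Here [D] is the diagonal matrix of the centered observable, [l *m D *m r = 0]
    says that its stationary mean vanishes, and [m1], [m2] satisfy the
    recursions of the path moments of order 1 and 2.  Centering kills the only
    term of [A^i D A^j] without geometric decay, so [m1] is bounded; the forcing
    term of [m2] is then bounded as well, and [m2] grows at most linearly. *)
Lemma centered_second_moment_growth N (A D : 'M[R]_N) (w l : 'rV[R]_N)
    (r : 'cV[R]_N) (rho K : R) (m1 m2 : nat -> 'rV[R]_N) :
  0 <= rho -> rho < 1 -> 0 <= K ->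
  (forall k, mxl1 (A ^+ k - r *m l) <= K * rho ^+ k) ->
  l *m D *m r = 0 ->
  m1 0 = w *m D ->
  (forall k, m1 k.+1 = m1 k *m A + w *m A ^+ k.+1 *m D) ->
  m2 0 = w *m D *m D ->
  (forall k, m2 k.+1 =
     m2 k *m A + (2 *: (m1 k.+1 *m D) - w *m A ^+ k.+1 *m D *m D)) ->
  exists2 C, 0 <= C & forall k, mxl1 (m2 k) <= C * k.+1%:R.
Proof.
move=> rho0 rho1 K0 hE lDr m10 m1S m20 m2S.
pose P := r *m l; pose a := mxl1 P + K.
have a0 : 0 <= a by rewrite addr_ge0 ?mxl1_ge0.
have hA k : mxl1 (A ^+ k) <= a.
  rewrite -[A ^+ k](subrK P) addrC; apply: le_trans (mxl1D _ _) _.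
  rewrite lerD2l; apply: le_trans (hE k) _.
  by rewrite ler_piMr// exprn_ile1// ltW.
pose c := mxl1 w * mxl1 D * a * K.
have c0 : 0 <= c by rewrite !mulr_ge0 ?mxl1_ge0.
have sandwich i j :
    mxl1 (w *m A ^+ i *m D *m A ^+ j) <= c * (rho ^+ i + rho ^+ j).
  have -> : w *m A ^+ i *m D *m A ^+ j =
     w *m (P *m (D *m (A ^+ j - P))) + w *m ((A ^+ i - P) *m (D *m A ^+ j)).
    rewrite -mulmxDr -!mulmxA; congr (_ *m _).
    rewrite !mulmxBr mulmxBl.
    have -> : r *m (l *m (D *m P)) = 0.
      by rewrite /P (mulmxA D) (mulmxA l) (mulmxA l) lDr mul0mx mulmx0.
    by rewrite subr0 /P -mulmxA subrKC.
  apply: le_trans (mxl1D _ _) _; rewrite mulrDr addrC; apply: lerD.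
    apply: le_trans (mxl1M _ _) _.
    rewrite /c -!mulrA ler_wpM2l ?mxl1_ge0//.
    apply: le_trans (mxl1M _ _) _.
    apply: (@le_trans _ _ (K * rho ^+ i * (mxl1 D * a))); last first.
      by rewrite le_eqVlt; apply/orP; left; apply/eqP; ring.
    rewrite ler_pM ?mxl1_ge0//; apply: le_trans (mxl1M _ _) _.
    by rewrite ler_wpM2l ?mxl1_ge0.
  apply: le_trans (mxl1M _ _) _.
  rewrite /c -!mulrA ler_wpM2l ?mxl1_ge0//.
  apply: le_trans (mxl1M _ _) _.
  apply: (@le_trans _ _ (a * (mxl1 D * (K * rho ^+ j)))); last first.
    by rewrite le_eqVlt; apply/orP; left; apply/eqP; ring.
  rewrite ler_pM ?mxl1_ge0//; first by rewrite lerDl.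
  by apply: le_trans (mxl1M _ _) _; rewrite ler_wpM2l ?mxl1_ge0.
pose s := (1 - rho)^-1.
have s0 : 0 <= s by rewrite invr_ge0 subr_ge0 ltW.
have m1_bound k : mxl1 (m1 k) <= c * (s + s).
  rewrite (@affine_recurrence _ A (fun i => w *m A ^+ i *m D)) ?mulmx1//.
  apply: le_trans (mxl1_sum _ _) _.
  apply: (@le_trans _ _ (\sum_(i < k.+1) c * (rho ^+ i + rho ^+ (k - i)))).
    by apply: ler_sum => i _; exact: sandwich.
  rewrite -mulr_sumr big_split /= ler_wpM2l// lerD ?geometric_sum_le//.
  rewrite (reindex_inj rev_ord_inj) /=.
  rewrite (eq_bigr (fun i : 'I_k.+1 => rho ^+ i)) ?geometric_sum_le// => i _.
  by rewrite subSS subKn// -ltnS.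
pose b := 2 * (c * (s + s) * mxl1 D) + mxl1 w * a * mxl1 D * mxl1 D.
have b0 : 0 <= b by rewrite addr_ge0 ?mulr_ge0 ?addr_ge0 ?mxl1_ge0.
have b_bound k :
    mxl1 (2 *: (m1 k *m D) - w *m A ^+ k *m D *m D) <= b.
  apply: le_trans (mxl1D _ _) _; rewrite -scaleN1r !mxl1Z normrN1 mul1r.
  rewrite ger0_norm//; apply: lerD.
    rewrite ler_wpM2l//; apply: le_trans (mxl1M _ _) _.
    by rewrite ler_wpM2r ?mxl1_ge0.
  do 3![apply: le_trans (mxl1M _ _) _; rewrite ?ler_wpM2r ?mxl1_ge0//].
  by rewrite ler_wpM2l ?mxl1_ge0.
exists (b * a); first by rewrite mulr_ge0.
move=> k.
rewrite (@affine_recurrence _ A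
  (fun k => 2 *: (m1 k *m D) - w *m A ^+ k *m D *m D)) //; last first.
  by rewrite m10 m20 mulmx1 scaler_nat mulr2n addrK.
apply: le_trans (mxl1_sum _ _) _.
apply: (@le_trans _ _ (\sum_(i < k.+1) b * a)).
  by apply: ler_sum => i _; apply: le_trans (mxl1M _ _) _; rewrite ler_pM ?mxl1_ge0.
by rewrite sumr_const card_ord mulr_natr.
Qed.

End MomentGrowth.

(** * Moments of additive functionals of paths *)

Section PathSums.
Variables (R : realType) (N : nat).
Implicit Types (K : 'M[R]_N) (w : 'rV[R]_N).

(** Moments are sums over all sequences of vertices; a step along which [K]
    vanishes gives mass 0, so only the paths of the graph of [K] count. *)
Definition path_mass K w k (z : {ffun 'I_k.+1 -> 'I_N}) : R :=
  w 0 (z ord0) * \prod_(i < k) K (step_src z i) (step_dst z i).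

Definition path_rcons k (z : {ffun 'I_k.+1 -> 'I_N}) (j : 'I_N) :
    {ffun 'I_k.+2 -> 'I_N} :=
  [ffun i => if unlift ord_max i is Some i' then z i' else j].

Lemma path_rcons_widen k (z : {ffun 'I_k.+1 -> 'I_N}) j i :
  path_rcons z j (widen_ord (leqnSn _) i) = z i.
Proof.
rewrite ffunE; have -> : widen_ord (leqnSn k.+1) i = lift ord_max i.
  by apply: val_inj => /=; rewrite /bump leqNgt ltn_ord.
by rewrite liftK.
Qed.

Lemma path_rcons_max k (z : {ffun 'I_k.+1 -> 'I_N}) j :
  path_rcons z j ord_max = j.
Proof. by rewrite ffunE unlift_none. Qed.

Lemma path_rcons_bij k :
  bijective (fun p : {ffun 'I_k.+1 -> 'I_N} * 'I_N => path_rcons p.1 p.2).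
Proof.
exists (fun z : {ffun 'I_k.+2 -> 'I_N} => ([ffun i => z (lift ord_max i)], z ord_max)).
  move=> [z j] /=; rewrite path_rcons_max; congr (_, _).
  by apply/ffunP => i; rewrite !ffunE liftK.
move=> z; apply/ffunP => i; rewrite !ffunE /=.
by case: unliftP => [i'|] ->; rewrite ?ffunE.
Qed.

Lemma path_mass_rcons K w k (z : {ffun 'I_k.+1 -> 'I_N}) j :
  path_mass K w (path_rcons z j) = path_mass K w z * K (z ord_max) j.
Proof.
rewrite /path_mass big_ord_recr /= mulrA; congr (_ * _ * _).
- congr (w 0 _); rewrite -(path_rcons_widen z j).
  by congr (path_rcons z j _); apply: val_inj.
- apply: eq_bigr => i _; rewrite /step_src /step_dst !path_rcons_widen; congr (K _ _).
  rewrite -(path_rcons_widen z j); congr (path_rcons z j _); exact: val_inj.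
rewrite /step_src /step_dst path_rcons_widen; congr (K _ _).
rewrite -[RHS](path_rcons_max z); congr (path_rcons z j _); exact: val_inj.
Qed.

Lemma sum_path_rcons k (h : 'I_N -> R) (z : {ffun 'I_k.+1 -> 'I_N}) j :
  \sum_i h (path_rcons z j i) = \sum_i h (z i) + h j.
Proof.
rewrite big_ord_recr /= path_rcons_max; congr (_ + _).
by apply: eq_bigr => i _; rewrite path_rcons_widen.
Qed.

Definition path_moment K w (h : 'I_N -> R) (p k : nat) : 'rV[R]_N :=
  \row_j \sum_(z : {ffun 'I_k.+1 -> 'I_N} | z ord_max == j)
    path_mass K w z * (\sum_i h (z i)) ^+ p.

Lemma path_moment_mul K w h p k (u : 'cV[R]_N) :
  (path_moment K w h p k *m u) 0 0 =
  \sum_(z : {ffun 'I_k.+1 -> 'I_N})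
    path_mass K w z * u (z ord_max) 0 * (\sum_i h (z i)) ^+ p.
Proof.
rewrite mxE (partition_big (fun z : {ffun 'I_k.+1 -> 'I_N} => z ord_max) xpredT)//=.
apply: eq_bigr => j _; rewrite mxE mulr_suml.
by apply: eq_bigr => z /eqP ->; rewrite mulrAC.
Qed.

(** A path of length [k.+1] is a path of length [k] with a last vertex appended,
    which multiplies the mass by one entry of [K] and adds one value of [h]. *)
Lemma path_momentS K w h p k j :
  path_moment K w h p k.+1 0 j =
  \sum_(z : {ffun 'I_k.+1 -> 'I_N})
    path_mass K w z * K (z ord_max) j * (\sum_i h (z i) + h j) ^+ p.
Proof.
rewrite mxE (reindex _ (onW_bij _ (@path_rcons_bij k))) /=.
rewrite (eq_bigl (fun p : {ffun 'I_k.+1 -> 'I_N} * 'I_N => true && (p.2 == j))).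
  rewrite -(pair_big xpredT (pred1 j)
    (fun z i => path_mass K w (path_rcons z i) *
                (\sum_i0 h (path_rcons z i i0)) ^+ p)) /=.
  apply: eq_bigr => z _; rewrite big_pred1_eq path_mass_rcons.
  by rewrite sum_path_rcons.
by move=> [z i] /=; rewrite path_rcons_max.
Qed.

Lemma path_moment_at0 K w h p :
  path_moment K w h p 0 = \row_j (w 0 j * h j ^+ p).
Proof.
apply/rowP => j; rewrite !mxE (big_pred1 [ffun=> j]) => [|z].
  by rewrite /path_mass big_ord0 mulr1 big_ord1 !ffunE.
apply/eqP/eqP => [zj|->]; last by rewrite ffunE.
by apply/ffunP => i; rewrite ffunE -zj ord1; congr (z _); apply: val_inj.
Qed.

Lemma path_moment_col K w h p k j :
  (path_moment K w h p k *m K) 0 j =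
  \sum_(z : {ffun 'I_k.+1 -> 'I_N})
    path_mass K w z * K (z ord_max) j * (\sum_i h (z i)) ^+ p.
Proof.
have -> : (path_moment K w h p k *m K) 0 j =
    (path_moment K w h p k *m col j K) 0 0.
  by rewrite !mxE; apply: eq_bigr => i _; rewrite [col j K _ _]mxE.
by rewrite path_moment_mul; apply: eq_bigr => z _; rewrite mxE.
Qed.

Lemma path_moment0S K w h k :
  path_moment K w h 0 k.+1 = path_moment K w h 0 k *m K.
Proof.
by apply/rowP => j; rewrite path_momentS path_moment_col; apply: eq_bigr.
Qed.

Lemma path_moment0 K w h k : path_moment K w h 0 k = w *m K ^+ k.
Proof.
elim: k => [|k IH].
  by rewrite mulmx1 path_moment_at0; apply/rowP => j; rewrite mxE expr0 mulr1.
by rewrite path_moment0S IH exprSr -mulmxA mulmxE.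
Qed.

Definition potential (h : 'I_N -> R) : 'M[R]_N := diag_mx (\row_j h j).

Lemma mul_potential h (v : 'rV[R]_N) j : (v *m potential h) 0 j = v 0 j * h j.
Proof. by rewrite mul_mx_diag !mxE. Qed.

Lemma path_moment_at0_potential K w h :
  path_moment K w h 1 0 = w *m potential h /\
  path_moment K w h 2 0 = w *m potential h *m potential h.
Proof.
by split; apply/rowP => j; rewrite path_moment_at0 !mul_potential mxE ?mulrA.
Qed.

Lemma path_moment1S K w h k :
  path_moment K w h 1 k.+1 =
  path_moment K w h 1 k *m K + w *m K ^+ k.+1 *m potential h.
Proof.
apply/rowP => j; rewrite path_momentS mxE mul_potential -(path_moment0 K w h).
rewrite path_momentS path_moment_col mulr_suml -big_split /=.
by apply: eq_bigr => z _; rewrite !expr0 !expr1 mulr1 mulrDr.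
Qed.

(** This is [(S + h)^2 = S^2 + 2 h (S + h) - h^2], summed over paths.  Writing the
    middle term with [S + h] makes the forcing at step [k.+1] a function of the
    lower moments at the same step. *)
Lemma path_moment2S K w h k :
  path_moment K w h 2 k.+1 =
  path_moment K w h 2 k *m K +
  (2 *: (path_moment K w h 1 k.+1 *m potential h) -
   w *m K ^+ k.+1 *m potential h *m potential h).
Proof.
apply/rowP => j; rewrite path_momentS.
have entry (X Y Z : 'rV[R]_N) :
  (X + (2 *: Y - Z)) 0 j = X 0 j + (2 * Y 0 j - Z 0 j) by rewrite !mxE.
rewrite -(path_moment0 K w h) entry !mul_potential path_moment_col.
rewrite !path_momentS !mulr_suml mulr_sumr -sumrB -big_split /=.
by apply: eq_bigr => z _; ring.
Qed.

End PathSums.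

(** * Integration against a law with finite support *)

Section FiniteLawIntegral.
Local Open Scope ereal_scope.
Variables (R : realType) (T : finType) (mu : T -> {nonneg R}) (X : T -> R).

Lemma ge0_integral_finite_law (f : R -> \bar R) :
  measurable_fun [set: R] f -> (forall x, 0 <= f x) ->
  \int[finite_law mu X]_x f x = \sum_(t : T) (mu t)%:num%:E * f (X t).
Proof.
move=> mf f0.
(* Sums of measures are indexed by [nat], hence the null measure outside the
   enumeration of [T]. *)
pose m_ (n : nat) : {measure set R -> \bar R} :=
  if insub n is Some i then
    mscale (mu (enum_val (i : 'I_#|T|))) (\d_(X (enum_val i)))
  else mzero.
have m_ord (i : 'I_#|T|) : m_ i = mscale (mu (enum_val i)) (\d_(X (enum_val i))).
  by rewrite /m_ valK.
rewrite (@eq_measure_integral _ _ _ _ (msum m_ #|T|)) => [|A _ _]; last first.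
  rewrite /= /finite_law (reindex (@enum_val T T)) /=.
    by apply: eq_bigr => i _; rewrite m_ord.
  exact: onW_bij (enum_val_bij T).
rewrite ge0_integral_measure_sum// (reindex (@enum_val T T)) /=; last first.
  exact: onW_bij (enum_val_bij T).
apply: eq_bigr => i _; rewrite m_ord ge0_integral_mscale//.
by rewrite integral_dirac// diracT mul1e.
Qed.

Lemma integral_finite_law (g : R -> R) : measurable_fun [set: R] g ->
  \int[finite_law mu X]_x (g x)%:E =
  (\sum_(t : T) (mu t)%:num * g (X t))%R%:E.
Proof.
move=> mg; have mG : measurable_fun [set: R] (EFin \o g) by exact/measurable_EFinP.
rewrite integralE !ge0_integral_finite_law//; last 2 first.
- exact: measurable_funeneg.
- exact: measurable_funepos.
rewrite (eq_bigr (fun t => ((mu t)%:num * Num.max (g (X t)) 0)%R%:E)); last first.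
  by move=> t _; rewrite funeposE EFinM EFin_max.
rewrite [X in _ - X](eq_bigr
  (fun t => ((mu t)%:num * Num.max (- g (X t)) 0)%R%:E)); last first.
  by move=> t _; rewrite funenegE EFinM EFin_max EFinN.
rewrite !sumEFin -EFinB -sumrB; congr EFin; apply: eq_bigr => t _.
rewrite -mulrBr; congr (_ * _)%R; rewrite /Num.max oppr_lt0.
by case: ltgtP => //; lra.
Qed.

End FiniteLawIntegral.

(** * The variance of the ergodic means *)

Section ErgodicMean.
Variables (R : realType) (N : nat) (G : cond_weighted_graph R N).
Local Notation M := (cwg_mx G).
Local Notation w := (cwg_in G).
Local Notation u := (cwg_out G).

Lemma prod_nonpath k (z : {ffun 'I_k.+1 -> 'I_N}) : ~~ is_path G z ->
  \prod_(i < k) M (step_src z i) (step_dst z i) = 0.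
Proof.
move=> /forallPn[j]; rewrite -leNgt => Mj0; rewrite (bigD1 j)//=.
suff -> : M (step_src z j) (step_dst z j) = 0 by rewrite mul0r.
by apply: le_anti; rewrite Mj0 cwg_mx_ge0.
Qed.

(** Passing from [M] to [L^-1 *: M] rescales all paths of length [k] by the same
    factor [L ^- k], which cancels in the weighted distribution. *)
Lemma sum_path_weight k (L : R) (Phi : {ffun 'I_k.+1 -> 'I_N} -> R) : L != 0 ->
  \sum_(z : cwg_path G k) path_weight z * Phi (val z) =
  L ^+ k * \sum_(z : {ffun 'I_k.+1 -> 'I_N})
    path_mass (L^-1 *: M) w z * u (z ord_max) 0 * Phi z.
Proof.
move=> L0; pose F (z : {ffun 'I_k.+1 -> 'I_N}) : R :=
  w 0 (z ord0) * (\prod_(i < k) M (step_src z i) (step_dst z i)) *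
  u (z ord_max) 0 * Phi z.
rewrite (eq_bigr (F \o val)) => [|z _]; last by [].
rewrite -(big_sub (fun z => is_path G z) F) mulr_sumr.
rewrite big_mkcond; apply: eq_bigr => z _ /=.
have -> : path_mass (L^-1 *: M) w z =
    L ^- k * (w 0 (z ord0) * \prod_(i < k) M (step_src z i) (step_dst z i)).
  rewrite mulrCA /path_mass; congr (_ * _).
  rewrite (eq_bigr (fun i => L^-1 * M (step_src z i) (step_dst z i))).
    by rewrite big_split /= prodr_const card_ord exprVn.
  by move=> i _; rewrite mxE.
rewrite -!mulrA mulVKf ?expf_neq0//.
case: ifPn => [_|zN]; first by rewrite /F !mulrA.
by rewrite prod_nonpath ?(mul0r, mulr0).
Qed.

(** The moment of order 2 of the sum of [f - gamma_f] is [O(k)] and the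
    normalised partition function is bounded away from 0, while the ergodic mean
    divides the sum by [k.+1]. *)
Lemma ergodic_mean_variance (pi : 'I_N -> R) (f : 'I_N -> R) :
  stationary_measure G pi ->
  exists2 C : R, 0 <= C & \forall k \near \oo, 0 < partition_fun G k /\
    \sum_(z : cwg_path G k) weighted_distribution z *
      (ergodic_mean f z - \sum_j pi j * f j) ^+ 2 <= C / k.+1%:R.
Proof.
move=> [lam [l [r [dom pp piE]]]].
have [wr0 lu0] := cwg_pos dom pp.
have [L [rho [K [L0 rho0 rho1 K0 hE]]]] :=
  perron_powers (cwg_order G) (cwg_mx_ge0 G) dom pp.
have lr1 : (l *m r) 0 0 = 1 by case: pp.
pose gam := \sum_j pi j * f j; pose h j := f j - gam.
have lDr : l *m potential h *m r = 0.
  apply/rowP => i; rewrite ord1 mxE [RHS]mxE.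
  rewrite (eq_bigr (fun j => pi j * f j - gam * (l 0 j * r j 0))); last first.
    by move=> j _; rewrite mul_potential piE /h; ring.
  rewrite sumrB -mulr_sumr (_ : \sum_i l 0 i * r i 0 = 1) ?mulr1 ?subrr//.
  by rewrite -lr1 mxE.
set A := L^-1 *: M in hE.
have [m10 m20] := path_moment_at0_potential A w h.
have [C C0 m2C] := centered_second_moment_growth rho0 rho1 K0 hE lDr
  m10 (path_moment1S A w h)
  m20 (path_moment2S A w h).
pose c := (w *m r) 0 0 * (l *m u) 0 0.
have c0 : 0 < c by rewrite mulr_gt0.
pose W k := (path_moment A w h 0 k *m u) 0 0.
have WE k : `|W k - c| <= mxl1 w * K * mxl1 u * rho ^+ k.
  have -> : W k - c = (w *m (A ^+ k - r *m l) *m u) 0 0.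
    rewrite /W path_moment0 mulmxBr mulmxBl.
    rewrite [RHS]mxE [X in _ = _ + X]mxE; congr (_ - _).
    by rewrite mulmxA -mulmxA [RHS]mxE big_ord1.
  apply: le_trans (mxl1_entry _ _ _) _; apply: le_trans (mxl1M _ _) _.
  rewrite -!mulrA (mulrC (mxl1 u)) !mulrA ler_wpM2r ?mxl1_ge0//.
  apply: le_trans (mxl1M _ _) _; rewrite -mulrA ler_wpM2l ?mxl1_ge0//.
have W_near : \forall k \near \oo, c / 2 <= W k.
  have : geometric (mxl1 w * K * mxl1 u) rho k @[k --> \oo] --> (0 : R).
    by apply: cvg_geometric; rewrite ger0_norm.
  move=> /cvgrPdist_le /(_ (c / 2)) => /(_ (divr_gt0 c0 (ltr0Sn _ 1))).
  apply: filterS => k; rewrite sub0r normrN /= => hk.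
  have := le_trans (WE k) (le_trans (ler_norm _) hk).
  by rewrite ler_distl => /andP[+ _]; lra.
have ZE k : partition_fun G k = L ^+ k * W k.
  rewrite /partition_fun (eq_bigr (fun z => path_weight z * 1)) ; last first.
    by move=> z _; rewrite mulr1.
  rewrite (sum_path_weight (fun=> 1) (lt0r_neq0 L0)) /W path_moment_mul.
  by congr (_ * _); apply: eq_bigr => z _; rewrite expr0.
exists (C * mxl1 u * (2 / c)).
  by rewrite !mulr_ge0 ?mxl1_ge0// invr_ge0 ltW.
apply: filterS W_near => k hW.
have W0 : 0 < W k by apply: lt_le_trans hW; rewrite divr_gt0.
have Lk0 : 0 < L ^+ k by rewrite exprn_gt0.
split; first by rewrite ZE mulr_gt0.
pose S (z : {ffun 'I_k.+1 -> 'I_N}) := \sum_i h (z i).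
have meanE (z : cwg_path G k) : ergodic_mean f z - gam = k.+1%:R^-1 * S (val z).
  rewrite /S /h sumrB sumr_const card_ord mulrBr -[gam *+ _]mulr_natl mulKf//.
rewrite -/gam (eq_bigr (fun z : cwg_path G k =>
   (k.+1%:R ^- 2 / partition_fun G k) * (path_weight z * S (val z) ^+ 2))); last first.
  by move=> z _; rewrite meanE /weighted_distribution exprMn exprVn; ring.
rewrite -mulr_sumr (sum_path_weight (fun z => S z ^+ 2) (lt0r_neq0 L0)) ZE.
rewrite -(path_moment_mul A w h 2 k u).
set V := (_ *m u) 0 0.
have -> : k.+1%:R ^- 2 / (L ^+ k * W k) * (L ^+ k * V) = k.+1%:R ^- 2 * (V / W k).
  by field; rewrite !gt_eqF//= ltr0n.
have hV : V <= C * k.+1%:R * mxl1 u.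
  apply: le_trans (ler_norm _) _; apply: le_trans (mxl1_entry _ _ _) _.
  by apply: le_trans (mxl1M _ _) _; rewrite ler_wpM2r ?mxl1_ge0.
have -> : C * mxl1 u * (2 / c) / k.+1%:R =
    k.+1%:R ^- 2 * ((C * k.+1%:R * mxl1 u) * (c / 2)^-1).
  by field; rewrite !gt_eqF//= ltr0n.
rewrite ler_wpM2l ?invr_ge0 ?exprn_ge0//.
apply: (@le_trans _ _ (C * k.+1%:R * mxl1 u / W k)).
  by rewrite ler_wpM2r// invr_ge0 ltW.
rewrite ler_wpM2l ?mulr_ge0 ?mxl1_ge0// lef_pV2// posrE// divr_gt0//.
Qed.

End ErgodicMean.

(** * Convergence in distribution *)

(** Near [a] continuity gives [eps]; at distance at least [d] from [a] the
    trivial bound [2 B] is at most [2 B (x - a)^2 / d^2]. *)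
Lemma continuous_quadratic_bound (R : realType) (g : R -> R) (a B eps : R) :
  {for a, continuous g} -> (forall x, `|g x| <= B) -> 0 < eps ->
  exists2 c, 0 <= c & forall x, `|g x - g a| <= eps + c * (x - a) ^+ 2.
Proof.
move=> /cvgrPdist_le ga gB eps0.
have /nbhs_ballP[d /= d0 hd] := ga _ eps0.
have B0 : 0 <= B by exact: le_trans (gB 0).
exists (2 * B / d ^+ 2); first by rewrite divr_ge0 ?mulr_ge0 ?exprn_ge0// ltW.
move=> x; have [xd|dx] := ltP `|a - x| d.
  rewrite distrC; apply: le_trans (hd x xd) _.
  by rewrite lerDl mulr_ge0 ?sqr_ge0// divr_ge0 ?mulr_ge0 ?exprn_ge0// ltW.
apply: (@le_trans _ _ (2 * B)).
  by apply: le_trans (ler_normB _ _) _; rewrite mulrDl mul1r lerD.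
rewrite -[leLHS]add0r; apply: lerD; first exact: ltW.
rewrite -[leRHS]mulrA ler_peMr ?mulr_ge0//.
rewrite mulrC ler_pdivlMr ?exprn_gt0// mul1r -[leRHS]real_normK ?num_real//.
by rewrite lerXn2r// ?nnegrE ?(ltW d0)// distrC.
Qed.

Theorem theorem5p1 (R : realType) (N : nat) (G : cond_weighted_graph R N)
    (pi : 'I_N -> R) (hpi : stationary_measure G pi) (f : 'I_N -> R) :
  cvg_in_distribution (ergodic_mean_law G f) (\d_(\sum_(j < N) pi j * f j)).
Proof.
move=> g cg [B gB]; set gam := \sum_(j < N) pi j * f j.
have mg : measurable_fun [set: R] g by exact: continuous_measurable_fun.
rewrite integral_dirac//; last exact/measurable_EFinP.
rewrite diracT mul1e.
pose E k : R := \sum_(z : cwg_path G k) weighted_distribution z * g (ergodic_mean f z).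
rewrite (_ : (fun k => _) = fun k => (E k)%:E); last first.
  by apply/funext => k; rewrite integral_finite_law.
apply: cvg_EFin; first exact: nearW.
apply/cvgrPdist_le => eps eps0.
have [C C0 hC] := ergodic_mean_variance f hpi.
have eps2 : 0 < eps / 2 by rewrite divr_gt0.
have [c c0 gc] := continuous_quadratic_bound (cg gam) gB eps2.
(* The [+ 1] keeps the denominator positive when [c] or [C] vanishes. *)
pose del := eps / 2 / (c * C + 1).
have cC1 : 0 < c * C + 1 by rewrite ltr_wpDl ?mulr_ge0.
have del0 : 0 < del by rewrite divr_gt0.
apply: filterS2 hC (near_infty_natSinv_lt (PosNum del0)) => k [Z0 var] /= kdel.
have sum1 : \sum_(z : cwg_path G k) weighted_distribution z = 1.
  by rewrite -mulr_suml divff// gt_eqF.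
rewrite /= distrC -[g gam]mul1r -sum1 mulr_suml -sumrB.
apply: le_trans (ler_norm_sum _ _ _) _.
apply: (@le_trans _ _ (\sum_(z : cwg_path G k)
   (weighted_distribution z * (eps / 2) +
    c * (weighted_distribution z * (ergodic_mean f z - gam) ^+ 2)))).
  apply: ler_sum => z _; rewrite -mulrBr normrM ger0_norm ?weighted_distribution_ge0//.
  by rewrite [c * _]mulrCA -mulrDr ler_wpM2l ?weighted_distribution_ge0.
rewrite big_split /= -mulr_suml -mulr_sumr sum1 mul1r.
have cCk : c * (C / k.+1%:R) <= eps / 2.
  rewrite mulrA; apply: (@le_trans _ _ ((c * C + 1) * del)).
    by rewrite ler_pM ?mulr_ge0 ?lerDl ?invr_ge0// ltW.
  by rewrite /del mulrC divfK// gt_eqF.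
by rewrite [leRHS]splitr lerD2l; apply: le_trans (ler_wpM2l c0 var) cCk.
Qed.
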